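(* Let $\mathcal{C}\subseteq\{0,1\}^n$ be a nonempty binary codebook, and consider $R=x(C)+N$, where $C$ is uniformly distributed over $\mathcal{C}$, $N\sim\mathcal{N}(\mathbf{0}_n,\Sigma)$ is independent of $C$, and $\Sigma=\Sigma^{\mathsf T}\succ0$. Fix a received observation $r\in\mathbb{R}^n$, with hard-decision word $y$ and energy $W_r$ as defined in the context. Let $z^{(1)},\ldots,z^{(2^n)}$ be a permutation of $\{0,1\}^n$ with $$W_r(z^{(1)})\le W_r(z^{(2)})\le\cdots\le W_r(z^{(2^n)}),$$ equal-energy patterns being ordered by a deterministic tie-breaking policy. Then the first codebook-hit index $$q_\star=\min\{q\in\{1,\ldots,2^n\}: y\oplus z^{(q)}\in\mathcal{C}\}$$ is well defined, and $\widehat{c}_{\mathrm{ML}}=y\oplus z^{(q_\star)}$ is a maximum-likelihood codeword, i.e. it maximizes the conditional density $f_{R|C}(r\mid c)$ over $c\in\mathcal{C}$. Moreover, because the prior on $\mathcal{C}$ is uniform, $\widehat{c}_{\mathrm{ML}}$ is also a maximum a posteriori codeword, i.e. it maximizes $\Pr\{C=c\mid R=r\}$ over $c\in\mathcal{C}$.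
   Context: Binary vectors are row vectors; real vectors are column vectors; $\oplus$ is componentwise addition over $\mathbb{F}_2$. For $c\in\{0,1\}^n$, $x(c)=(1-2c_1,\ldots,1-2c_n)^{\mathsf T}\in\{-1,+1\}^n$. $f_{R|C}(r\mid c)$ is the $\mathcal{N}(x(c),\Sigma)$ density at $r$. Let $Q=\Sigma^{-1}$. For $r\in\mathbb{R}^n$: $y_i=0$ if $r_i\ge0$ and $y_i=1$ otherwise; $s=x(y)$; $a=r-s$; and for $z\in\{0,1\}^n$, $$W_r(z)=\sum_{i=1}^n\alpha_iz_i+\sum_{1\le i<j\le n}\beta_{ij}z_iz_j,\qquad \alpha_i=2s_i(Qa)_i+2Q_{ii},\quad \beta_{ij}=4s_is_jQ_{ij}.$$ The sequence $z^{(1)},\ldots,z^{(2^n)}$ is the order in which the decoder queries noise-effect patterns: with query budget $\tau=2^n$ (complete enumeration) the decoder tests $y\oplus z^{(q)}\in\mathcal{C}$ for $q=1,2,\ldots$ and returns the first word that belongs to $\mathcal{C}$. *)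

(* Defs.v *)
From HB Require Import structures.
From mathcomp Require Import all_boot all_order all_algebra.
From mathcomp Require Import all_classical all_reals all_analysis.
Set Implicit Arguments.
Unset Strict Implicit.
Unset Printing Implicit Defensive.
Import Order.TTheory GRing.Theory Num.Theory.
Import numFieldNormedType.Exports.
Local Open Scope classical_set_scope.
Local Open Scope ring_scope.

(** Real vectors are columns ['cV[R]_n]; binary words are rows ['rV['F_2]_n],
    so that their sum [+] is the componentwise addition over F_2. *)

Definition posdefmx (R : realType) (n : nat) (S : 'M[R]_n) : Prop :=
  forall v : 'cV[R]_n, v != 0 -> 0 < (v^T *m S *m v) 0 0.

(** Multivariate Gaussian density
    [((2 pi)^n det S)^(-1/2) exp (- (r - m)^T S^-1 (r - m) / 2)]. *)
Definition gauss_pdf (R : realType) (n : nat) (m : 'cV[R]_n) (S : 'M[R]_n)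
    (r : 'cV[R]_n) : R :=
  (Num.sqrt ((2 * pi) ^+ n * \det S))^-1
    * expR (- (((r - m)^T *m invmx S *m (r - m)) 0 0) / 2).

Section Energy.
Variables (R : realType) (n : nat).
Implicit Types (S : 'M[R]_n) (r : 'cV[R]_n) (z c : 'rV['F_2]_n).

Definition bit (b : 'F_2) : R := (b : nat)%:R.

Definition bpsk c : 'cV[R]_n := \col_i (1 - 2 * bit (c 0 i)).

Definition hard_dec r : 'rV['F_2]_n :=
  \row_i (if 0 <= r i 0 then 0 else 1).

Definition energy_lin S r (i : 'I_n) : R :=
  let Q := invmx S in
  let s := bpsk (hard_dec r) in
  let a := r - s in
  2 * s i 0 * (Q *m a) i 0 + 2 * Q i i.

Definition energy_quad S r (i j : 'I_n) : R :=
  let Q := invmx S in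
  let s := bpsk (hard_dec r) in
  4 * s i 0 * s j 0 * Q i j.

Definition energy S r z : R :=
  \sum_(i < n) energy_lin S r i * bit (z 0 i)
  + \sum_(i < n) \sum_(j < n | (i < j)%N)
      energy_quad S r i j * bit (z 0 i) * bit (z 0 j).

End Energy.

Arguments bpsk {R n} c.

(** Queries are numbered from 0: the pattern [z q] is the [q.+1]-th query. *)
Definition first_hit (n : nat) (Code : {set 'rV['F_2]_n}) (y : 'rV['F_2]_n)
    (z : 'I_(2 ^ n) -> 'rV['F_2]_n) (q : 'I_(2 ^ n)) : Prop :=
  y + z q \in Code /\
  forall q' : 'I_(2 ^ n), y + z q' \in Code -> (q <= q')%N.

Definition is_ML (R : realType) (n : nat) (Code : {set 'rV['F_2]_n})
    (S : 'M[R]_n) (r : 'cV[R]_n) (c : 'rV['F_2]_n) : Prop :=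
  c \in Code /\
  forall c' : 'rV['F_2]_n, c' \in Code ->
    gauss_pdf (bpsk c') S r <= gauss_pdf (bpsk c) S r.

(** Lebesgue measure on R^n, with R^n represented by [n.-tuple R], which
    carries the product sigma-algebra. *)
Section LebesgueRn.
Variable R : realType.
Local Open Scope ereal_scope.

Fixpoint lebesgue_Rn (n : nat) : set (n.-tuple R) -> \bar R :=
  match n return set (n.-tuple R) -> \bar R with
  | 0 => dirac ([tuple] : 0.-tuple R)
  | m.+1 => pushforward (@lebesgue_measure R \x @lebesgue_Rn m)
      (fun p : R * m.-tuple R => [tuple of p.1 :: p.2])
  end.

Let cons_tuple_measurable (m : nat) :
  measurable_fun setT (fun p : R * m.-tuple R => [tuple of p.1 :: p.2]).
Proof. exact: (measurable_cons measurable_fst measurable_snd). Qed.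

Let lebesgue_Rn_ex (n : nat) :
  exists mu : {sigma_finite_measure set (n.-tuple R) -> \bar R},
    lebesgue_Rn (n := n) = mu.
Proof.
elim: n => [|m [mu mumu]]; first by exists (dirac ([tuple] : 0.-tuple R)).
pose f := fun p : R * m.-tuple R => [tuple of p.1 :: p.2].
pose g := fun t : m.+1.-tuple R =>
  (thead t, [tuple of behead t] : m.-tuple R).
have mf : measurable_fun setT f := @cons_tuple_measurable m.
have mg : measurable_fun setT g.
  apply/measurable_fun_pairP; split; first exact: measurable_tnth.
  exact: measurable_behead.
have fK : cancel f g.
  by move=> [x t]; rewrite /f /g /=; congr pair; exact/val_inj.
(* [\x] has no canonical sigma-finite structure on a pair of sigma-finite
   measures, hence the explicit instances and the proof of [ps] below. *)
pose nu : {measure set (measurableTypeR R * m.-tuple R)%type -> \bar R} :=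
  lebesgue_integral_fubini_product_measure1__canonical__measure_function_Measure
    (@lebesgue_measure R) mu.
pose p : {measure set (m.+1.-tuple R) -> \bar R} :=
  measure_function_pushforward__canonical__measure_function_Measure nu mf.
have ps : sigma_finite setT p.
  have /sigma_finiteP[F [TF ndF Foo]] := sigma_finiteT (@lebesgue_measure R).
  have /sigma_finiteP[G [TG ndG Goo]] := sigma_finiteT mu.
  exists (fun k => g @^-1` (F k `*` G k)).
    apply/esym/seteqP; split=> // t _.
    have : [set: R] (g t).1 by [].
    have : setT (g t).2 by [].
    rewrite TF TG => -[k _ Gk] [l _ Fl]; exists (maxn k l) => //; split.
      by move: Fl; exact/subsetPset/ndF/leq_maxr.
    by move: Gk; exact/subsetPset/ndG/leq_maxl.
  move=> k; have [mF Fk] := Foo k; have [mG Gk] := Goo k; split.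
    by rewrite -[X in measurable X]setTI; apply: mg => //; exact: measurableX.
  rewrite /p /= /pushforward -comp_preimage (_ : g \o f = id); last first.
    by apply/funext => x /=; exact: fK.
  by rewrite product_measure1E// lte_mul_pinfty// ge0_fin_numE.
pose H := Measure_isSigmaFinite.Build _ _ _ p ps.
pose q : {sigma_finite_measure set (m.+1.-tuple R) -> \bar R} :=
  HB.pack_for {sigma_finite_measure set (m.+1.-tuple R) -> \bar R} (Measure.sort p) H.
by exists q; rewrite /= mumu.
Qed.

Let lebesgue_Rn0 (n : nat) : lebesgue_Rn (n := n) set0 = 0.
Proof. by have [mu ->] := lebesgue_Rn_ex n; exact: measure0. Qed.

Let lebesgue_Rn_ge0 (n : nat) A : 0 <= lebesgue_Rn (n := n) A.
Proof. by have [mu ->] := lebesgue_Rn_ex n; exact: measure_ge0. Qed.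

Let lebesgue_Rn_sigma_additive (n : nat) :
  semi_sigma_additive (lebesgue_Rn (n := n)).
Proof.
by have [mu ->] := lebesgue_Rn_ex n; exact: measure_semi_sigma_additive.
Qed.

HB.instance Definition _ (n : nat) := isMeasure.Build _ _ _
  (lebesgue_Rn (n := n)) (@lebesgue_Rn0 n) (@lebesgue_Rn_ge0 n)
  (@lebesgue_Rn_sigma_additive n).

Let lebesgue_Rn_sigma_finite (n : nat) :
  sigma_finite setT (lebesgue_Rn (n := n)).
Proof. by have [mu ->] := lebesgue_Rn_ex n; exact: sigma_finiteT. Qed.

HB.instance Definition _ (n : nat) := Measure_isSigmaFinite.Build _ _ _
  (lebesgue_Rn (n := n)) (@lebesgue_Rn_sigma_finite n).

End LebesgueRn.

Section Channel.
Variables (R : realType) (n : nat) (d : measure_display).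
Variables (T : measurableType d) (P : probability T R).
Implicit Types (C : T -> 'rV['F_2]_n) (N : {RV P >-> n.-tuple R}).

(** Words form a finite set, so all the sets of words are events. *)
Definition word_rv C : Prop :=
  forall B : set 'rV['F_2]_n, measurable (C @^-1` B).

Definition uniform_on C (Code : {set 'rV['F_2]_n}) : Prop :=
  forall c : 'rV['F_2]_n,
    P (C @^-1` [set c]) = (if c \in Code then #|Code|%:R^-1 else 0)%:E.

Definition col_of_tuple (t : n.-tuple R) : 'cV[R]_n := \col_i tnth t i.

Definition gaussian_rv N (m : 'cV[R]_n) (S : 'M[R]_n) : Prop :=
  forall A : set (n.-tuple R), measurable A ->
    distribution P N A
    = (\int[@lebesgue_Rn R n]_(t in A) (gauss_pdf m S (col_of_tuple t))%:E)%E.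

Definition independent_rv C N : Prop :=
  forall (B : set 'rV['F_2]_n) (A : set (n.-tuple R)), measurable A ->
    (P (C @^-1` B `&` N @^-1` A) = P (C @^-1` B) * P (N @^-1` A))%E.

Definition received C N (w : T) : 'cV[R]_n :=
  bpsk (C w) + col_of_tuple (N w).

(** [p] is the conditional probability of the event [E] given [Y = r]. The
    latter event may be negligible: [p] is the limit of the elementary
    conditional probabilities [P (E | Y \in ball r e)] when [e] tends to 0
    from the right, where [ball r e] is the open sup-norm ball. *)
Definition cond_prob_at (E : set T) (Y : T -> 'cV[R]_n) (r : 'cV[R]_n)
    (p : R) : Prop :=
  (fun e : R => fine (P (E `&` Y @^-1` ball r e)) / fine (P (Y @^-1` ball r e)))
    @ 0^'+ --> p.

(** The posterior probabilities [post c] of [C = c] given [Y = r] exist, and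
    [chat] maximizes them over the codebook. *)
Definition is_MAP C (Y : T -> 'cV[R]_n) (Code : {set 'rV['F_2]_n})
    (r : 'cV[R]_n) (chat : 'rV['F_2]_n) : Prop :=
  chat \in Code /\
  exists2 post : 'rV['F_2]_n -> R,
    (forall c, c \in Code -> cond_prob_at (C @^-1` [set c]) Y r (post c)) &
    (forall c, c \in Code -> post c <= post chat).

End Channel.

(* Main.v *)
(** Write [x] for [bpsk] and [y] for the hard decision. The quadratic form
    [(r - x c)^T S^-1 (r - x c)] at [c = y + z] is its value at [c = y] plus
    twice the energy of [z], so querying in order of energy is querying in order
    of decreasing likelihood, and the first hit is a maximum-likelihood word.

    For the posterior, [C = c] and [Y \in ball r e] hold together iff [C = c] and
    [N] lies in the cube of radius [e] about [r - x c]. All these cubes have the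
    same volume [(2 e)^n], and the mean of the continuous noise density over
    such a cube tends to the likelihood of [c]. Hence the elementary conditional
    probabilities tend to the Bayes posterior, which for a uniform prior is
    proportional to the likelihood. *)

Require Import Defs.
From HB Require Import structures.
From mathcomp Require Import all_boot all_order all_algebra.
From mathcomp Require Import all_classical all_reals all_analysis.
From mathcomp Require Import measurable_realfun ring lra.
Import Order.TTheory GRing.Theory Num.Theory.
Import numFieldNormedType.Exports.
Local Open Scope classical_set_scope.
Local Open Scope ring_scope.


(** * Quadratic forms, signs, and the energy as a distance increment *)

Lemma sum_sum_symmetric (R : realType) (n : nat) (F : 'I_n -> 'I_n -> R) :
  (forall i j, F i j = F j i) ->
  \sum_i \sum_j F i j
  = \sum_i F i i + 2 * \sum_(i < n) \sum_(j < n | (i < j)%N) F i j.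
Proof.
move=> Fsym.
have split3 (i : 'I_n) : \sum_j F i j
    = F i i + \sum_(j < n | (i < j)%N) F i j + \sum_(j < n | (j < i)%N) F i j.
  rewrite (bigD1 i)//= -addrA; congr (_ + _).
  rewrite (bigID (fun j : 'I_n => (i < j)%N))/=; congr (_ + _); apply: eq_bigl => j.
    by rewrite neq_ltn; case: ltngtP.
  by rewrite neq_ltn; case: ltngtP.
rewrite (eq_bigr _ (fun i _ => split3 i)) !big_split/= -addrA; congr (_ + _).
rewrite mulr_natl mulr2n; congr (_ + _).
rewrite (exchange_big_dep xpredT)//=.
by apply: eq_bigr => i _; apply: eq_bigr.
Qed.

Lemma mx11_quadE (R : realType) (n : nat) (Q : 'M[R]_n) (u v : 'cV[R]_n) :
  (u^T *m Q *m v) 0 0 = \sum_i u i 0 * (Q *m v) i 0.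
Proof. by rewrite -mulmxA mxE; apply: eq_bigr => i _; rewrite mxE. Qed.

Lemma bilinear_form_sym (R : realType) (n : nat) (Q : 'M[R]_n) (u v : 'cV[R]_n) :
  Q^T = Q -> (u^T *m Q *m v) 0 0 = (v^T *m Q *m u) 0 0.
Proof.
move=> Qs; have -> : (u^T *m Q *m v) = (v^T *m Q *m u)^T.
  by rewrite !trmx_mul trmxK Qs mulmxA.
by rewrite mxE.
Qed.

Lemma quad_formD (R : realType) (n : nat) (Q : 'M[R]_n) (a b : 'cV[R]_n) :
  Q^T = Q ->
  ((a + b)^T *m Q *m (a + b)) 0 0
  = (a^T *m Q *m a) 0 0 + 2 * (b^T *m Q *m a) 0 0 + (b^T *m Q *m b) 0 0.
Proof.
move=> Qs; have -> : (a + b)^T = a^T + b^T by rewrite linearD.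
rewrite !mulmxDl !mulmxDr.
rewrite [LHS]mxE [X in X + _ = _]mxE [X in _ + X = _]mxE.
by rewrite (bilinear_form_sym _ _ _ a b)//; ring.
Qed.

Lemma bit_idem (R : realType) (b : 'F_2) : bit R b * bit R b = bit R b.
Proof. by rewrite /bit; case: b => [[|[|//]] ?] /=; rewrite ?mulr0 ?mulr1. Qed.

Lemma bpsk_sqr (R : realType) (n : nat) (c : 'rV['F_2]_n) i :
  @bpsk R n c i 0 * bpsk c i 0 = 1.
Proof. by rewrite mxE; have := bit_idem R (c 0 i); set x := bit _ _; lra. Qed.

(** Addition over F_2 becomes multiplication of signs, since [1 - 2 * bit R b] is the sign attached
    to [b]. *)
Lemma bpskD (R : realType) (n : nat) (y z : 'rV['F_2]_n) i :
  @bpsk R n (y + z) i 0 = bpsk y i 0 * (1 - 2 * bit R (z 0 i)).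
Proof.
rewrite !mxE /bit.
case: (y 0 i) => [[|[|//]] ?]; case: (z 0 i) => [[|[|//]] ?] /=.
- by rewrite modn_small//; ring.
- by rewrite modn_small//; ring.
- by rewrite modn_small//; ring.
- by rewrite (_ : (_ %% _)%N = 0%N)//; ring.
Qed.

(** The square of the Mahalanobis distance from [r] to the modulated word. *)
Definition mahalanobis (R : realType) (n : nat) (S : 'M[R]_n) (r : 'cV[R]_n)
    (c : 'rV['F_2]_n) : R :=
  ((r - bpsk c)^T *m invmx S *m (r - bpsk c)) 0 0.

(** Expand the form at [a + b], where [b] is the displacement caused by flipping along [z]. The
    cross term and the diagonal of the [b] part give the linear coefficients; the off-diagonal pairs
    give the quadratic ones. *)
Lemma mahalanobis_energy (R : realType) (n : nat) (S : 'M[R]_n) (r : 'cV[R]_n)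
    (z : 'rV['F_2]_n) :
  S^T = S ->
  mahalanobis R n S r (hard_dec r + z)
  = mahalanobis R n S r (hard_dec r) + 2 * energy S r z.
Proof.
move=> Ss; rewrite /mahalanobis; set y := hard_dec r; set Q := invmx S.
have Qs : Q^T = Q by rewrite /Q trmx_inv Ss.
set s : 'cV[R]_n := bpsk y; set a := r - s.
(* This is [bpsk y - bpsk (y + z)]: a flip at [i] moves that coordinate from [s i 0] to its
   opposite. *)
pose b : 'cV[R]_n := \col_i (2 * s i 0 * bit R (z 0 i)).
have -> : r - bpsk (y + z) = a + b.
  apply/colP => i; transitivity (r i 0 - bpsk (y + z) i 0); first by rewrite 2!mxE.
  transitivity ((r i 0 - s i 0) + 2 * s i 0 * bit R (z 0 i)).
    by rewrite bpskD -/s; ring.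
  by rewrite !mxE.
rewrite quad_formD// -addrA; congr (_ + _).
have bE i : b i 0 = 2 * s i 0 * bit R (z 0 i) by rewrite mxE.
have -> : (b^T *m Q *m b) 0 0 = \sum_i \sum_j b i 0 * Q i j * b j 0.
  rewrite mx11_quadE; apply: eq_bigr => i _.
  rewrite [X in _ * X]mxE big_distrr/=.
  by apply: eq_bigr => j _; rewrite mulrA.
have Qij i j : Q i j = Q j i by rewrite -{1}Qs mxE.
rewrite (sum_sum_symmetric R n (fun i j => b i 0 * Q i j * b j 0)); last first.
  by move=> i j; rewrite (Qij i j); ring.
rewrite mx11_quadE /energy mulrDr addrA; congr (_ + _).
  rewrite !mulr_sumr -big_split/=; apply: eq_bigr => i _.
  rewrite /energy_lin -/y -/s -/a -/Q !bE.
  have := bpsk_sqr R n y i; have := bit_idem R (z 0 i); rewrite -/s.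
  set w := bit _ _; set t := s i 0; set q := Q i i; set u := (Q *m a) i 0.
  move: w t q u => w t q u ww tt.
  (* The diagonal term is quadratic in the sign [t] and the bit [w]; it becomes linear because
     [t * t = 1] and [w * w = w]. *)
  transitivity (4 * t * u * w + 4 * q * (t * t) * (w * w)); first by ring.
  by rewrite tt ww; ring.
congr (_ * _); apply: eq_bigr => i _; apply: eq_bigr => j _.
by rewrite /energy_quad -/y -/s -/Q !bE; ring.
Qed.

(** All words share the same nonnegative normalizing factor, so only the exponents are compared. *)
Lemma gauss_pdf_le_energy (R : realType) (n : nat) (S : 'M[R]_n) (r : 'cV[R]_n)
    (z z' : 'rV['F_2]_n) :
  S^T = S -> energy S r z <= energy S r z' ->
  gauss_pdf (bpsk (hard_dec r + z')) S r <= gauss_pdf (bpsk (hard_dec r + z)) S r.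
Proof.
move=> Ss le_zz'; rewrite /gauss_pdf -!/(mahalanobis R n S r _).
rewrite !mahalanobis_energy//; apply: ler_wpM2l.
  by rewrite invr_ge0 sqrtr_ge0.
by rewrite ler_expR ler_pM2r ?invr_gt0// lerN2 lerD2l ler_pM2l.
Qed.

(** * The first codebook hit *)

Lemma first_hit_unique (n : nat) (Code : {set 'rV['F_2]_n}) (y : 'rV['F_2]_n)
    (z : 'I_(2 ^ n) -> 'rV['F_2]_n) :
  Code != finset.set0 -> bijective z -> exists! q, first_hit Code y z q.
Proof.
move=> /set0Pn[c cC] [z' zK z'K].
(* Surjectivity of [z] guarantees a hit: the pattern [c - y] is queried, and it turns [y] into the
   codeword [c]. *)
have hit0 : y + z (z' (c - y)) \in Code by rewrite z'K subrKC.
have [q hitq minq] := @arg_minnP _ _ (fun q => y + z q \in Code) (fun q => q : nat) hit0.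
exists q; split=> [|q' [hitq' minq']]; first by split.
by apply/val_inj/eqP; rewrite eqn_leq minq// minq'.
Qed.

(** Every codeword is itself a hit at some query; minimality puts that query no earlier than [q],
    hence at no smaller energy. *)
Lemma first_hit_is_ML (R : realType) (n : nat) (Code : {set 'rV['F_2]_n})
    (S : 'M[R]_n) (r : 'cV[R]_n) (z : 'I_(2 ^ n) -> 'rV['F_2]_n) q :
  S^T = S -> bijective z ->
  (forall q q' : 'I_(2 ^ n), (q <= q')%N ->
    energy S r (z q) <= energy S r (z q')) ->
  first_hit Code (hard_dec r) z q -> is_ML Code S r (hard_dec r + z q).
Proof.
move=> Ss [z' zK z'K] sorted [hitq minq]; split=> // c cC.
have yz' : hard_dec r + z (z' (c - hard_dec r)) = c by rewrite z'K subrKC.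
rewrite -yz'; apply: gauss_pdf_le_energy => //.
by apply/sorted/minq; rewrite yz'.
Qed.


(** * Volumes of cubes and means over shrinking cubes *)

(** The center is a function of the index, so that an induction on the dimension drops a coordinate
    by composing with [lift ord0]. *)
Definition cube (R : realType) (n : nat) (v : 'I_n -> R) (e : R) : set (n.-tuple R) :=
  [set t | forall i, ball (v i) e (tnth t i)].

Lemma measurable_cube (R : realType) (n : nat) (v : 'I_n -> R) e :
  measurable (cube R n v e).
Proof.
have -> : cube R n v e
    = \bigcap_(i in [set: 'I_n]) ((@tnth n R)^~ i @^-1` ball (v i) e).
  by apply/seteqP; split=> [t tv i _|t tv i]; [exact: tv|exact: tv i I].
apply: fin_bigcap_measurable => [|i _]; first exact: finite_finset.
by rewrite -[X in measurable X]setTI; apply: measurable_tnth => //; exact: measurable_ball.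
Qed.

Lemma lebesgue_Rn_cube (R : realType) (n : nat) (v : 'I_n -> R) e :
  0 <= e -> @lebesgue_Rn R n (cube R n v e) = ((e *+ 2) ^+ n)%:E.
Proof.
move=> e0; elim: n v => [|n IHn] v.
  (* In dimension 0 the cube contains the empty tuple vacuously, and the Dirac mass there is 1. *)
  by rewrite expr0 /= diracE mem_set// => -[].
rewrite /= /pushforward.
have -> : (fun p : R * n.-tuple R => [tuple of p.1 :: p.2]) @^-1` cube R n.+1 v e
    = ball (v ord0) e `*` cube R n (fun i => v (lift ord0 i)) e.
  apply/seteqP; split=> [[x t]|[x t]] /=.
    move=> xt; split; first by have := xt ord0; rewrite tnth0.
    by move=> i; have := xt (lift ord0 i); rewrite tnthS.
  by move=> [vx vt] i; case: (unliftP ord0 i) => [j|] ->; rewrite ?tnth0 ?tnthS.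
rewrite product_measure1E//; [|exact: measurable_ball|exact: measurable_cube].
rewrite exprS EFinM; congr (_ * _)%E; [exact: lebesgue_measure_ball|exact: IHn].
Qed.

Lemma ball_col_of_tuple (R : realType) (n : nat) (v : 'cV[R]_n) (e : R) (t : n.-tuple R) :
  0 < e -> ball v e (col_of_tuple t) <-> cube R n (fun i => v i 0) e t.
Proof.
move=> e0; split=> [[_ vt] i|vt]; first by have := vt i 0; rewrite mxE.
by split=> // i j; rewrite ord1 mxE.
Qed.

(** Lebesgue differentiation at a point of continuity: on a small cube [f] stays within [eps] of
    [f v], which traps the integral between two multiples of the volume. *)
Lemma cvg_mean_cube (R : realType) (n : nat) (f : 'cV[R]_n -> R) (v : 'cV[R]_n) :
  (forall u, 0 <= f u) ->
  measurable_fun setT (fun t : n.-tuple R => f (col_of_tuple t)) ->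
  {for v, continuous f} ->
  (fun e : R =>
    fine (\int[@lebesgue_Rn R n]_(t in cube R n (fun i => v i 0%R) e)
      (f (col_of_tuple t))%:E)%E / (e *+ 2) ^+ n) @ 0^'+ --> f v.
Proof.
move=> f0 mf /cvgrPdist_le cf; apply/cvgrPdist_le => eps eps0.
have /nbhs_ballP[dl /= dl0 dlP] := cf _ eps0.
near=> e.
have e0 : 0 < e by near: e; exact: nbhs_right_gt.
have ed : e < dl by near: e; exact: nbhs_right_lt.
set A := cube _ _ _ _.
have mA : measurable A := measurable_cube _ _ _ _.
have mfA : measurable_fun A (fun t : n.-tuple R => (f (col_of_tuple t))%:E).
  by apply/measurable_EFinP; exact: measurable_funS mf.
have m0 : 0 < (e *+ 2) ^+ n by rewrite exprn_gt0// mulrn_wgt0.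
have Am : @lebesgue_Rn R n A = ((e *+ 2) ^+ n)%:E by exact/lebesgue_Rn_cube/ltW.
have near_v t : A t -> `|f v - f (col_of_tuple t)| <= eps.
  move=> At; apply: dlP; apply: (le_ball (ltW ed)).
  exact/ball_col_of_tuple.
set I := (\int[_]_(_ in _) _)%E.
(* The maximum with 0 keeps the lower bound nonnegative, as monotonicity of the integral is applied
   to nonnegative functions. *)
have loI : ((Num.max 0 (f v - eps) * (e *+ 2) ^+ n)%:E <= I)%E.
  rewrite EFinM -Am -(@integral_cst _ _ _ (@lebesgue_Rn R n) _ mA).
  apply: ge0_le_integral => //= t At; rewrite lee_fin ?le_max ?lexx//.
  by rewrite ge_max f0/=; have := near_v t At; rewrite ler_norml; lra.
have hiI : (I <= ((f v + eps) * (e *+ 2) ^+ n)%:E)%E.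
  rewrite EFinM -Am -(@integral_cst _ _ _ (@lebesgue_Rn R n) _ mA).
  apply: ge0_le_integral => //= t At; rewrite lee_fin//.
  by have := near_v t At; rewrite ler_norml; lra.
have Ifin : I \is a fin_num.
  rewrite fin_numE -ltNye -ltey (lt_le_trans _ loI) ?ltNyr//=.
  by rewrite (le_lt_trans hiI)// ltry.
rewrite -(fineK Ifin) !lee_fin in loI hiI.
rewrite ler_distlC ler_pdivrMr// hiI ler_pdivlMr// andbT.
by apply: le_trans loI; rewrite ler_pM2r// le_max lexx orbT.
Unshelve. all: by end_near.
Qed.


(** * Regularity and positivity of the Gaussian density *)

Lemma gauss_pdf_center (R : realType) (n : nat) (m : 'cV[R]_n) (S : 'M[R]_n)
    (r : 'cV[R]_n) :
  gauss_pdf m S r = gauss_pdf 0 S (r - m).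
Proof. by rewrite /gauss_pdf subr0. Qed.

Lemma gauss_pdf_ge0 (R : realType) (n : nat) (m : 'cV[R]_n) (S : 'M[R]_n)
    (r : 'cV[R]_n) : 0 <= gauss_pdf m S r.
Proof. by rewrite mulr_ge0 ?invr_ge0 ?sqrtr_ge0 ?expR_ge0. Qed.

(** A form in coordinates, from which continuity and measurability follow by closure under sums and
    products. *)
Lemma gauss_pdf0E (R : realType) (n : nat) (S : 'M[R]_n) (v : 'cV[R]_n) :
  gauss_pdf 0 S v = (Num.sqrt ((2 * pi) ^+ n * \det S))^-1
    * expR (- 2^-1 * \sum_i v i 0 * \sum_j invmx S i j * v j 0).
Proof.
rewrite /gauss_pdf; congr (_ * expR _).
have -> : ((v - 0)^T *m invmx S *m (v - 0)) 0 0
    = \sum_i v i 0 * \sum_j invmx S i j * v j 0.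
  by rewrite subr0 mx11_quadE; apply: eq_bigr => i _; rewrite [X in _ * X]mxE.
by rewrite mulNr mulrC -mulNr.
Qed.

Lemma continuous_sum_fun (R : realType) (U : topologicalType) (I : finType)
    (F : I -> U -> R) :
  (forall i, continuous (F i)) -> continuous (fun x => \sum_i F i x).
Proof.
move=> cF; apply: continuous_big => [|i _]; last exact: cF.
exact: add_continuous.
Qed.

Lemma continuous_gauss_pdf0 (R : realType) (n : nat) (S : 'M[R]_n) :
  continuous (@gauss_pdf R n 0 S).
Proof.
have -> : gauss_pdf 0 S = (fun v => (Num.sqrt ((2 * pi) ^+ n * \det S))^-1
    * expR (- 2^-1 * \sum_i v i 0 * \sum_j invmx S i j * v j 0)).
  by apply/funext => v; exact: gauss_pdf0E.
pose q (v : 'cV[R]_n) := \sum_i v i 0 * \sum_j invmx S i j * v j 0.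
have cq : continuous q.
  have cc i : continuous (fun v : 'cV[R]_n => v i 0).
    exact: (@coord_continuous R n 1 i 0).
  apply: continuous_sum_fun => i v.
  apply: continuousM; first exact: cc.
  apply: continuous_sum_fun => j {}v.
  by apply: continuousM; [exact: cst_continuous|exact: cc].
set k := (Num.sqrt _)^-1 => v.
apply: (@continuousM _ _ (cst k) (fun u => expR (- 2^-1 * q u))).
  exact: cst_continuous.
apply: (@continuous_comp _ _ _ (fun u => - 2^-1 * q u) expR).
  by apply: continuousM; [exact: cst_continuous|exact: cq].
exact: continuous_expR.
Qed.

Lemma measurable_gauss_pdf0 (R : realType) (n : nat) (S : 'M[R]_n) :
  measurable_fun setT (fun t : n.-tuple R => gauss_pdf 0 S (col_of_tuple t)).
Proof.
have -> : (fun t : n.-tuple R => gauss_pdf 0 S (col_of_tuple t)) =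
   (fun t => (Num.sqrt ((2 * pi) ^+ n * \det S))^-1
    * expR (- 2^-1 * \sum_i tnth t i * \sum_j invmx S i j * tnth t j)).
  apply/funext => v; rewrite gauss_pdf0E; congr (_ * expR (_ * _)).
  apply: eq_bigr => i _; rewrite mxE; congr (_ * _).
  by apply: eq_bigr => j _; rewrite mxE.
apply: measurable_funM => //; apply: measurableT_comp; first exact: measurable_expR.
apply: measurable_funM => //.
apply: measurable_sum => i; apply: measurable_funM; first exact: measurable_tnth.
apply: measurable_sum => j; apply: measurable_funM => //; exact: measurable_tnth.
Qed.

(* A vanishing normalizing constant would make the law of [N] null, so the
   determinant of [S] need not be computed. *)
Lemma gauss_pdf_gt0 (R : realType) (n : nat) (d : measure_display)
    (T : measurableType d) (P : probability T R) (N : {RV P >-> n.-tuple R})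
    (m0 m : 'cV[R]_n) (S : 'M[R]_n) (r : 'cV[R]_n) :
  gaussian_rv N m0 S -> 0 < gauss_pdf m S r.
Proof.
move=> gN; rewrite lt_def gauss_pdf_ge0 andbT.
apply: mulf_neq0; last by rewrite gt_eqF// expR_gt0.
apply/eqP => k0.
have := gN setT measurableT; rewrite probability_setT.
rewrite integral0_eq => [/eqP|t _]; first by rewrite onee_eq0.
by rewrite /gauss_pdf k0 mul0r.
Qed.

(** * The posterior as a limit of elementary conditional probabilities *)

Section Posterior.
Variables (R : realType) (n : nat) (Code : {set 'rV['F_2]_n}) (S : 'M[R]_n).
Variables (d : measure_display) (T : measurableType d) (P : probability T R).
Variables (C : T -> 'rV['F_2]_n) (N : {RV P >-> n.-tuple R}) (r : 'cV[R]_n).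
Hypotheses (C_rv : word_rv C) (C_unif : uniform_on P C Code).
Hypotheses (N_gauss : gaussian_rv N 0 S) (CN_indep : independent_rv C N).

Let prior (c : 'rV['F_2]_n) : R := if c \in Code then #|Code|%:R^-1 else 0.

Let box c e := cube R n (fun i => (r - bpsk c) i 0) e.

Let mean c e : R :=
  fine (\int[@lebesgue_Rn R n]_(t in box c e)
         (gauss_pdf 0 S (col_of_tuple t))%:E)%E / (e *+ 2) ^+ n.

Lemma word_received_event c e : 0 < e ->
  C @^-1` [set c] `&` received C N @^-1` ball r e
  = C @^-1` [set c] `&` N @^-1` box c e.
Proof.
move=> e0.
have shift w i : r i 0 - (bpsk c + col_of_tuple (N w)) i 0
    = (r - bpsk c) i 0 - tnth (N w) i by rewrite !mxE; ring.
apply/seteqP; split=> w /= [Cw]; rewrite /received /= Cw.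
  move=> [_ rw]; split=> // i; have := rw i 0.
  by rewrite /ball/= shift.
move=> bw; split=> //; split=> // i j; have := bw i.
by rewrite ord1 /ball/= shift.
Qed.

Lemma measurable_word_received c e : 0 < e ->
  measurable (C @^-1` [set c] `&` received C N @^-1` ball r e).
Proof.
move=> e0; rewrite word_received_event//; apply: measurableI; first exact: C_rv.
by rewrite -[X in measurable X]setTI; apply: measurable_funPT => //; exact: measurable_cube.
Qed.

(** Independence separates the prior from the noise probability. The volume is kept as an explicit
    factor, common to all words, so that it cancels in the conditional probability. *)
Lemma prob_word_received c e : 0 < e ->
  fine (P (C @^-1` [set c] `&` received C N @^-1` ball r e))
  = prior c * mean c e * (e *+ 2) ^+ n.
Proof.
move=> e0; rewrite word_received_event// CN_indep; last exact: measurable_cube.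
have PN : P (N @^-1` box c e)
    = (\int[@lebesgue_Rn R n]_(t in box c e)
        (gauss_pdf 0 S (col_of_tuple t))%:E)%E.
  exact: N_gauss (measurable_cube _ _ _ _).
have Nfin : P (N @^-1` box c e) \is a fin_num.
  apply: fin_num_measure; rewrite -[X in measurable X]setTI.
  by apply: measurable_funPT => //; exact: measurable_cube.
rewrite C_unif fineM//= PN -mulrA divfK//.
by rewrite expf_neq0// gt_eqF// mulrn_wgt0.
Qed.

Lemma prob_received e : 0 < e ->
  fine (P (received C N @^-1` ball r e))
  = (\sum_c prior c * mean c e) * (e *+ 2) ^+ n.
Proof.
move=> e0; pose F c := C @^-1` [set c] `&` received C N @^-1` ball r e.
(* Total probability over all words: those outside the codebook have prior 0. The finite union also
   makes the event measurable. *)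
have -> : received C N @^-1` ball r e
    = \bigcup_(c in [set` index_enum 'rV['F_2]_n]) F c.
  apply/seteqP; split=> [w rw|w [c _ []]//].
  by exists (C w) => //=; rewrite mem_index_enum.
have mF c : measurable (F c) by exact: measurable_word_received.
rewrite measure_fin_bigcup//; last first.
  by move=> c c' _ _ [w [[/= <- _] [/= <- _]]].
rewrite -fsbig_seq ?index_enum_uniq//= big_distrl/= -sum_fine; last first.
  by move=> c _; exact: fin_num_measure.
by apply: eq_bigr => c _; exact: prob_word_received.
Qed.

Lemma cvg_mean c : mean c @ 0^'+ --> gauss_pdf (bpsk c) S r.
Proof.
rewrite gauss_pdf_center; apply: cvg_mean_cube.
- by move=> u; exact: gauss_pdf_ge0.
- exact: measurable_gauss_pdf0.
- exact: continuous_gauss_pdf0.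
Qed.

(** One codeword already contributes a positive term. This makes the limit of the denominators
    nonzero. *)
Lemma evidence_gt0 : Code != finset.set0 ->
  0 < \sum_c prior c * gauss_pdf (bpsk c) S r.
Proof.
move=> /set0Pn[c cC]; rewrite (bigD1 c)//= ltr_pwDl//.
  rewrite mulr_gt0 ?(gauss_pdf_gt0 _ _ _ _ P N 0)// /prior cC invr_gt0 ltr0n.
  by apply/card_gt0P; exists c.
apply: sumr_ge0 => c' _; rewrite mulr_ge0 ?gauss_pdf_ge0// /prior.
by case: ifP.
Qed.

Lemma cond_prob_word c : Code != finset.set0 ->
  cond_prob_at P (C @^-1` [set c]) (received C N) r
    (prior c * gauss_pdf (bpsk c) S r
      / \sum_c' prior c' * gauss_pdf (bpsk c') S r).
Proof.
move=> C0; rewrite /cond_prob_at.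
(* Bayes' formula with each likelihood replaced by its mean over a cube; for positive [e] this is
   exactly the elementary conditional probability. *)
have lim : (fun e => prior c * mean c e / \sum_c' prior c' * mean c' e) @ 0^'+
    --> prior c * gauss_pdf (bpsk c) S r
      / \sum_c' prior c' * gauss_pdf (bpsk c') S r.
  apply: cvgM; first by apply: cvgMl_tmp; exact: cvg_mean.
  apply: cvgV; first by rewrite gt_eqF// evidence_gt0.
  apply: cvg_big => [|c' _]; first exact: add_continuous.
  by apply: cvgMl_tmp; exact: cvg_mean.
apply: cvg_trans lim; apply: near_eq_cvg; near=> e.
have e0 : 0 < e by near: e; exact: nbhs_right_gt.
rewrite prob_word_received// prob_received// -mulf_div divff ?mulr1//.
by rewrite expf_neq0// gt_eqF// mulrn_wgt0.
Unshelve. all: by end_near.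
Qed.

(** On the codebook the prior is constant and the evidence does not depend on the word, so the
    posterior is a fixed nonnegative multiple of the likelihood. *)
Lemma ML_is_MAP c : is_ML Code S r c -> is_MAP P C (received C N) Code r c.
Proof.
move=> [cC maxc]; have C0 : Code != finset.set0 by apply/set0Pn; exists c.
split=> //; exists (fun c => prior c * gauss_pdf (bpsk c) S r
      / \sum_c' prior c' * gauss_pdf (bpsk c') S r).
  by move=> c' _; exact: cond_prob_word.
move=> c' c'C; rewrite ler_pM2r ?invr_gt0 ?evidence_gt0// /prior cC c'C.
by rewrite ler_wpM2l ?invr_ge0// maxc.
Qed.

End Posterior.

Theorem mainTheorem2 (R : realType) (n : nat) (Code : {set 'rV['F_2]_n})
    (S : 'M[R]_n)
    (d : measure_display) (T : measurableType d) (P : probability T R)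
    (C : T -> 'rV['F_2]_n) (N : {RV P >-> n.-tuple R})
    (r : 'cV[R]_n) (z : 'I_(2 ^ n) -> 'rV['F_2]_n) :
  Code != finset.set0 ->
  S^T = S -> posdefmx S ->
  word_rv C -> uniform_on P C Code ->
  gaussian_rv N 0 S -> independent_rv C N ->
  bijective z ->
  (forall q q' : 'I_(2 ^ n), (q <= q')%N ->
    energy S r (z q) <= energy S r (z q')) ->
  (exists! q : 'I_(2 ^ n), first_hit Code (hard_dec r) z q) /\
  (forall q : 'I_(2 ^ n), first_hit Code (hard_dec r) z q ->
    is_ML Code S r (hard_dec r + z q) /\
    is_MAP P C (received C N) Code r (hard_dec r + z q)).
Proof.
move=> C0 Ss _ C_rv C_unif N_gauss CN_indep z_bij sorted; split.
  exact: first_hit_unique.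
move=> q hit; have ML : is_ML Code S r (hard_dec r + z q).
  exact: first_hit_is_ML.
split; first exact: ML.
exact: ML_is_MAP C_rv C_unif N_gauss CN_indep _ ML.
Qed.
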